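(* Let $k\ge1$, let $\alpha_1,\beta_1,\beta_2\in\mathbb{R}$ with $\alpha_1^2+\beta_1\beta_2\neq\frac14$, and assume a uniform mesh of size $h$ with $N$ cells. Let $$\Gamma:=\beta_1+\frac{k^2(k^2-1)}{h^2}\beta_2-\frac{2k^2}{h}\left(\alpha_1^2+\beta_1\beta_2+\frac14\right),\qquad \Lambda:=-\frac{2k}{h}\left(\alpha_1^2+\beta_1\beta_2-\frac14\right).$$ Then: Case 1. If $|\Gamma|>|\Lambda|$, then $P_h^\star$ exists and is uniquely defined. Case 2. If $|\Gamma|=|\Lambda|$, then $P_h^\star$ exists and is uniquely defined if $N$ is odd and, furthermore, $\Gamma=-\Lambda$ when $k$ is odd, and $\Gamma=\Lambda$ when $k$ is even. Case 3. If $|\Gamma|<|\Lambda|$, then $P_h^\star$ exists and is uniquely defined if $$(-1)^{(k+1)N}\left(\frac{\Gamma}{\Lambda}+\sqrt{\left(\frac{\Gamma}{\Lambda}\right)^2-1}\right)^N\neq1 .$$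
   Context: Mesh: $I=[a,b]$, $a=x_{1/2}<x_{3/2}<\dots<x_{N+1/2}=b$, $I_j=(x_{j-1/2},x_{j+1/2})$, uniform with $x_{j+1/2}-x_{j-1/2}=h=(b-a)/N$. $V_h^k$ is the space of functions on $I$ whose restriction to each $I_j$ is a polynomial of degree at most $k$. At an interface, $v^\pm$ denote the limits from the right ($+$) and left ($-$) cells, with periodic identification of $x_{1/2}$ and $x_{N+1/2}$; $[v]=v^+-v^-$, $\{v\}=\frac12(v^++v^-)$; the same notation is used for the piecewise derivative $v_x$. Projection $P_h^\star$ (depending on $\alpha_1,\beta_1,\beta_2$): for a periodic function $u\in W^{1,\infty}(I)$ (such that the interface values of $u$ and $u_x$ are meaningful), $P_h^\star u$ is the unique $w\in V_h^k$ satisfying, for all $j=1,\dots,N$, (i) $\int_{I_j}w\,v_h\,dx=\int_{I_j}u\,v_h\,dx$ for all $v_h\in P^{k-2}(I_j)$ (void if $k=1$); (ii) $\{w\}-\alpha_1[w]+\beta_2[w_x]=u$ at $x_{j+1/2}$; (iii) $\{w_x\}+\alpha_1[w_x]+\beta_1[w]=u_x$ at $x_{j+1/2}$. ''$P_h^\star$ exists and is uniquely defined'' means that for every such $u$ there is exactly one such $w$. In Case 3 the square root of the negative number is $i\sqrt{1-(\Gamma/\Lambda)^2}$. *)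

(* Defs.v *)
From HB Require Import structures.
From mathcomp Require Import all_boot all_order all_algebra.
From mathcomp Require Import complex.
From mathcomp Require Import all_classical all_reals all_analysis.

Set Implicit Arguments.
Unset Strict Implicit.
Unset Printing Implicit Defensive.

Import Order.TTheory GRing.Theory Num.Theory.
Import numFieldNormedType.Exports.

Local Open Scope classical_set_scope.
Local Open Scope ring_scope.

Definition in_Linfty {R : realType} (a b : R) (u : R -> R) : Prop :=
  measurable_fun `]a, b[ u /\
  finite_norm (@lebesgue_measure R) +oo%E (u \_ `]a, b[).

Definition test_function {R : realType} (a b : R) (phi : R -> R) : Prop :=
  (forall n x, derivable (derive1n n phi) x 1) /\
  exists c d, [/\ a < c, d < b & forall x, phi x != 0 -> c <= x <= d].

Definition weak_derivative {R : realType} (a b : R) (u g : R -> R) : Prop :=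
  forall phi, test_function a b phi ->
    \int[lebesgue_measure]_(x in `]a, b[) (u x * derive1 phi x) =
    - \int[lebesgue_measure]_(x in `]a, b[) (g x * phi x).

Definition in_W1infty {R : realType} (a b : R) (u : R -> R) : Prop :=
  in_Linfty a b u /\ exists2 g, in_Linfty a b g & weak_derivative a b u g.

Definition mesh_size {R : realType} (a b : R) (N : nat) : R := (b - a) / N%:R.

(* [node j] is x_{j+1/2}; cells and interfaces are numbered from 0, so that
   [i : 'I_N] stands for the cell I_{i+1} and for its right end x_{i+3/2}. *)
Definition node {R : realType} (a b : R) (N : nat) (j : nat) : R :=
  a + j%:R * mesh_size a b N.

Definition cell {R : realType} (a b : R) {N : nat}
    (i : 'I_N) : set R := `]node a b N i, node a b N i.+1[.

(* Traces at the right end of cell [i].  The cell to the right of that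
   interface is [ordS i], which is cell 0 for the last one: x_{1/2} and
   x_{N+1/2} are identified. *)
Definition trace_minus {R : realType} (a b : R) {N : nat}
    (v : R -> R) (i : 'I_N) : R :=
  lim (v x @[x --> (node a b N i.+1)^'-]).
Definition trace_plus {R : realType} (a b : R) {N : nat}
    (v : R -> R) (i : 'I_N) : R :=
  lim (v x @[x --> (node a b N (ordS i))^'+]).

Definition jump {R : realType} (a b : R) {N : nat}
    (v : R -> R) (i : 'I_N) : R :=
  trace_plus a b v i - trace_minus a b v i.
Definition average {R : realType} (a b : R) {N : nat}
    (v : R -> R) (i : 'I_N) : R :=
  (trace_plus a b v i + trace_minus a b v i) / 2.

(* V_h^k.  Only the values inside the cells are meaningful; elements are
   compared with [eq_on_cells]. *)
Definition broken_poly {R : realType} (a b : R) (N : nat)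
    (k : nat) (w : R -> R) : Prop :=
  forall i : 'I_N, exists2 p : {poly R},
    (size p <= k.+1)%N & forall x, cell a b i x -> w x = p.[x].

Definition eq_on_cells {R : realType} (a b : R) (N : nat)
    (w1 w2 : R -> R) : Prop :=
  forall (i : 'I_N) x, cell a b i x -> w1 x = w2 x.

(* The functions that P_h^* is applied to: the continuous representative of a
   periodic W^{1,oo} function, extended to R by periodicity, whose derivative
   exists at the interfaces. *)
Definition projectable {R : realType} (a b : R) (N : nat)
    (u : R -> R) : Prop :=
  [/\ periodic u (b - a), continuous u, in_W1infty a b u &
      forall i : 'I_N, derivable u (node a b N i.+1) 1].

(* In the first condition v ranges over polynomials of degree <= k - 2,
   that is [size v <= k - 1]; for k = 1 this leaves only v = 0. *)
Definition is_projection {R : realType} (a b : R) (N : nat)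
    (k : nat) (alpha1 beta1 beta2 : R)
    (u w : R -> R) : Prop :=
  [/\ broken_poly a b N k w,
      forall (i : 'I_N) (v : {poly R}), (size v <= k.-1)%N ->
        \int[lebesgue_measure]_(x in cell a b i) (w x * v.[x]) =
        \int[lebesgue_measure]_(x in cell a b i) (u x * v.[x]),
      forall i : 'I_N,
        average a b w i - alpha1 * jump a b w i
          + beta2 * jump a b (derive1 w) i = u (node a b N i.+1) &
      forall i : 'I_N,
        average a b (derive1 w) i + alpha1 * jump a b (derive1 w) i
          + beta1 * jump a b w i = derive1 u (node a b N i.+1)].

Definition projection_well_defined {R : realType} (a b : R) (N : nat)
    (k : nat) (alpha1 beta1 beta2 : R) : Prop :=
  forall u, projectable a b N u ->
    exists w, is_projection a b N k alpha1 beta1 beta2 u w /\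
      forall w', is_projection a b N k alpha1 beta1 beta2 u w' ->
        eq_on_cells a b N w' w.

Definition Gamma_k {R : realType} (k : nat) (h alpha1 beta1 beta2 : R) : R :=
  beta1 + (k%:R ^+ 2 * (k%:R ^+ 2 - 1)) / h ^+ 2 * beta2
  - 2 * k%:R ^+ 2 / h * (alpha1 ^+ 2 + beta1 * beta2 + 1 / 4).

Definition Lambda_k {R : realType} (k : nat) (h alpha1 beta1 beta2 : R) : R :=
  - (2 * k%:R / h) * (alpha1 ^+ 2 + beta1 * beta2 - 1 / 4).

(* Main.v *)
(* By finite dimensionality it suffices that the homogeneous problem has only
   the zero solution.  On a cell with ends A < B a polynomial of degree <= m+1
   (k = m+1) orthogonal to P^{m-1} is the m-th derivative of
   (x-A)^m (x-B)^m l(x) with l affine, so its traces are explicit in the two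
   coefficients of l.  The interface conditions relate the coefficients of
   neighbouring cells by a 2x2 transfer matrix of determinant 1 and trace
   2 (-1)^m Gamma / Lambda; by Cayley-Hamilton each coefficient is an
   N-periodic solution of
     Lambda (z_{n+2} + z_n) = 2 (-1)^m Gamma z_{n+1},
   which vanishes as soon as a root r of the characteristic polynomial (the
   other root is 1/r) satisfies r^N <> 1. *)
From HB Require Import structures.
Require Import Defs.
From mathcomp Require Import all_boot all_order all_algebra.
From mathcomp Require Import complex.
From mathcomp Require Import all_classical all_reals all_analysis.
From mathcomp Require Import ring lra zify.

Set Implicit Arguments.
Unset Strict Implicit.
Unset Printing Implicit Defensive.

Import Order.TTheory GRing.Theory Num.Theory.
Import numFieldNormedType.Exports.
Local Open Scope ring_scope.
Local Open Scope complex_scope.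

(** * Formal integration of polynomials *)

(** At index 0 the coefficient is a division by 0, hence 0, so this antiderivative vanishes at 0. *)
Definition primitivep {R : numFieldType} (p : {poly R}) : {poly R} :=
  \poly_(i < (size p).+1) (p`_i.-1 / i%:R).

Lemma coef_primitivep {R : numFieldType} (p : {poly R}) i :
  (primitivep p)`_i = p`_i.-1 / i%:R.
Proof.
rewrite coef_poly; case: ltnP => // hi.
by rewrite nth_default ?mul0r //; case: i hi.
Qed.

Lemma deriv_primitivep {R : numFieldType} (p : {poly R}) : (primitivep p)^`() = p.
Proof.
apply/polyP => i.
by rewrite coef_deriv coef_primitivep -[LHS]mulr_natr mulfVK ?pnatr_eq0.
Qed.

Lemma size_primitivep {R : numFieldType} (p : {poly R}) :
  (size (primitivep p) <= (size p).+1)%N.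
Proof. exact: size_poly. Qed.

(** Algebraic integral from [A] to [B]; [Rintegral_poly] identifies it with the Lebesgue
    integral. *)
Definition integralp {R : numFieldType} (A B : R) (p : {poly R}) : R :=
  (primitivep p).[B] - (primitivep p).[A].

Lemma integralp_deriv {R : numFieldType} (A B : R) (p : {poly R}) :
  integralp A B p^`() = p.[B] - p.[A].
Proof.
rewrite /integralp; suff -> : primitivep p^`() = p - (p`_0)%:P.
  by rewrite !hornerE; ring.
apply/polyP => -[|i]; rewrite coef_primitivep coefB coefC /=.
  by rewrite invr0 mulr0 subrr.
by rewrite coef_deriv -[X in X / _]mulr_natr mulfK ?subr0 // pnatr_eq0.
Qed.

Lemma integralpD {R : numFieldType} (A B : R) (p q : {poly R}) :
  integralp A B (p + q) = integralp A B p + integralp A B q.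
Proof.
by rewrite -[in LHS](deriv_primitivep p) -[in LHS](deriv_primitivep q) -derivD
  integralp_deriv /integralp !hornerD opprD addrACA.
Qed.

Lemma integralpZ {R : numFieldType} (A B c : R) (p : {poly R}) :
  integralp A B (c *: p) = c * integralp A B p.
Proof.
by rewrite -[in LHS](deriv_primitivep p) -derivZ integralp_deriv /integralp !hornerZ mulrBr.
Qed.

(** * Rodrigues form of polynomials orthogonal to low degrees *)

Lemma deriv_XsubC_exp_mul {R : comRingType} m (c : R) (s : {poly R}) :
  (('X - c%:P) ^+ m.+1 * s)^`() =
  ('X - c%:P) ^+ m * (m.+1%:R *: s + ('X - c%:P) * s^`()).
Proof.
rewrite derivM deriv_exp derivXsubC /= exprS -scaler_nat; set u := _ ^+ m.
by rewrite -!mul_polyC; ring.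
Qed.

Lemma derivn_XsubC_exp {R : comRingType} m (c : R) (s : {poly R}) :
  ((('X - c%:P) ^+ m * s)^`(m)).[c] = m`!%:R * s.[c] /\
  ((('X - c%:P) ^+ m * s)^`(m.+1)).[c] = m.+1`!%:R * s^`().[c].
Proof.
elim: m s => [|m IH] s.
  by rewrite expr0 mul1r derivn0 derivn1 factS fact0 !mul1r.
rewrite derivSn [in X in _ /\ X]derivSn deriv_XsubC_exp_mul.
case: (IH (m.+1%:R *: s + ('X - c%:P) * s^`())) => -> ->.
split; rewrite ?derivD ?derivZ ?derivM ?derivXsubC.
  by rewrite hornerD hornerZ hornerM hornerXsubC factS natrM; ring.
rewrite mul1r !(hornerXsubC, hornerM, hornerZ, hornerD) [in RHS]factS natrM.
by rewrite -[m.+2%:R]natr1; ring.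
Qed.

(** Induction on [m], integrating once. The antiderivative [Q] vanishing at [A] also vanishes at
    [B], because [q] is orthogonal to 1; integration by parts then makes [Q] orthogonal to one
    degree less. Its two zeros pass to [l] and supply the missing factors X - A and X - B. The
    [maxn] allows for a zero [l]. *)
Lemma orthogonal_rodrigues {R : numFieldType} (A B : R) m (q : {poly R}) :
  A != B ->
  (forall v : {poly R}, (size v <= m)%N -> integralp A B (q * v) = 0) ->
  exists2 l : {poly R},
    q = (('X - A%:P) ^+ m * (('X - B%:P) ^+ m * l))^`(m) &
    (size l + m <= maxn (size q) m)%N.
Proof.
move=> neAB; elim: m q => [|m IH] q orth.
  by exists q; rewrite ?expr0 ?mul1r ?derivn0 // addn0 maxn0.
pose Q := primitivep q - (primitivep q).[A]%:P.
have dQ : Q^`() = q by rewrite derivB derivC subr0 deriv_primitivep.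
have QA : Q.[A] = 0 by rewrite !hornerE subrr.
have QB : Q.[B] = 0.
  have := orth 1; rewrite size_poly1 mulr1 => /(_ isT) <-.
  by rewrite -[in RHS]dQ integralp_deriv QA subr0.
have sQ : (size Q <= (size q).+1)%N.
  apply: leq_trans (size_polyD _ _) _.
  by rewrite geq_max size_primitivep size_polyN (leq_trans (size_polyC_leq1 _)).
have orthQ (v : {poly R}) : (size v <= m)%N -> integralp A B (Q * v) = 0.
  move=> sv.
  have e : integralp A B (Q * primitivep v)^`() = 0.
    by rewrite integralp_deriv !hornerM QA QB !mul0r subrr.
  move: e; rewrite derivM integralpD dQ deriv_primitivep orth ?add0r //.
  exact: leq_trans (size_primitivep _) _.
have [l Ql sl] := IH Q orthQ.
have fm : m`!%:R != 0 :> R by rewrite pnatr_eq0 -lt0n fact_gt0.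
(* By [derivn_XsubC_exp], [Q.[A]] is m! (A - B)^m l(A), and [A] differs from [B]. *)
have lA : l.[A] = 0.
  have [+ _] := derivn_XsubC_exp m A (('X - B%:P) ^+ m * l).
  rewrite -Ql QA !hornerE => /esym/eqP.
  rewrite !mulf_eq0 (negPf fm) expf_eq0 subr_eq0 (negPf neAB) andbF /=.
  by move/eqP.
have lB : l.[B] = 0.
  have [+ _] := derivn_XsubC_exp m B (('X - A%:P) ^+ m * l).
  rewrite mulrCA -Ql QB !hornerE => /esym/eqP.
  rewrite !mulf_eq0 (negPf fm) expf_eq0 subr_eq0 (eq_sym B) (negPf neAB) andbF /=.
  by move/eqP.
have /factor_theorem [l1 el1] : root l A by apply/rootP.
have /factor_theorem [l2 el2] : root l1 B.
  move/eqP: lB; rewrite el1 !hornerE mulf_eq0 subr_eq0 (eq_sym B) (negPf neAB) orbF; exact.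
exists l2.
  rewrite -[LHS]dQ Ql derivnS el1 el2; congr (_^`(m)^`()).
  by rewrite !exprS; ring.
have [-> | l2n0] := eqVneq l2 0; first by rewrite size_poly0 leq_maxr.
have s1 : size l1 = (size l2).+1.
  by rewrite el2 size_Mmonic ?monicXsubC // size_XsubC addn2.
have : size l = (size l2).+2.
  rewrite el1 size_Mmonic ?monicXsubC ?size_XsubC ?addn2 ?s1 //.
  by rewrite -size_poly_eq0 s1.
move: sl sQ => + + e; rewrite e !leq_max.
by set p1 := size Q; set p2 := size q; set p3 := size l2; clearbody p1 p2 p3; clear; lia.
Qed.

(** The Rodrigues factor [l] is affine; [x] and [x + y] are its values at [A] and [B], scaled by m!
    (B - A)^m. The sign at [A] comes from (A - B)^m. *)
Lemma orthogonal_endpoints {R : numFieldType} (A B : R) m (q : {poly R}) :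
  A != B -> (size q <= m.+2)%N ->
  (forall v : {poly R}, (size v <= m)%N -> integralp A B (q * v) = 0) ->
  let K := m.+1%:R / (B - A) in
  exists xy : R * R, let: (x, y) := xy in
  [/\ x = 0 -> y = 0 -> q = 0,
      q.[A] = (-1) ^+ m * x,
      q^`().[A] = (-1) ^+ m * (K * (y - m%:R * x)),
      q.[B] = x + y &
      q^`().[B] = K * (m%:R * (x + y) + y)].
Proof.
move=> neAB sq orth K.
have [l ql sl] := orthogonal_rodrigues neAB orth.
have h0 : B - A != 0 by rewrite subr_eq0 eq_sym.
have sl2 : (size l <= 2)%N by move: sl sq; clear; lia.
have el : l = (l`_0)%:P + l`_1 *: 'X.
  apply/polyP => i; rewrite coefD coefZ coefX coefC.
  case: i => [|[|i]] /=; rewrite ?mulr0 ?mulr1 ?addr0 ?add0r //.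
  by rewrite nth_default // (leq_trans sl2).
have lE c : l.[c] = l`_0 + l`_1 * c by rewrite {1}el !hornerE.
have l'E c : l^`().[c] = l`_1 by rewrite {1}el derivD derivC derivZ derivX !hornerE.
pose c := m`!%:R * (B - A) ^+ m.
have [qA q'A] := derivn_XsubC_exp m A (('X - B%:P) ^+ m * l).
have [qB q'B] := derivn_XsubC_exp m B (('X - A%:P) ^+ m * l).
rewrite mulrCA -ql in qB; rewrite mulrCA derivnS -ql in q'B.
rewrite -ql in qA; rewrite derivnS -ql in q'A.
(* The factor [v - u] restores the m-th power, so the formula is uniform in [m], including m = 0. *)
have dexp (u v : R) : (('X - u%:P) ^+ m * l)^`().[v] * (v - u) =
    (v - u) ^+ m * (m%:R * l.[v] + (v - u) * l^`().[v]).
  case: (m) => [|j]; first by rewrite expr0 !mul1r mul0r add0r mulrC.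
  rewrite deriv_XsubC_exp_mul exprS.
  by rewrite !(hornerXsubC, horner_exp, hornerM, hornerZ, hornerD); ring.
have c0 : c != 0.
  by rewrite mulf_neq0 ?expf_neq0 // pnatr_eq0 -lt0n fact_gt0.
have eAB : (A - B) ^+ m = (-1) ^+ m * (B - A) ^+ m.
  by rewrite -exprMn; congr (_ ^+ m); ring.
exists (c * l.[A], c * ((B - A) * l`_1)); split.
- move=> /eqP; rewrite mulf_eq0 (negPf c0) /= lE => /eqP lA /eqP.
  rewrite mulf_eq0 (negPf c0) mulf_eq0 (negPf h0) /= => /eqP l1.
  rewrite l1 mul0r addr0 in lA.
  by rewrite ql el l1 lA scale0r addr0 !mulr0 linear0.
- by rewrite qA hornerM horner_exp hornerXsubC eAB /c; ring.
- rewrite q'A; apply: (mulIf h0); rewrite -mulrA.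
  have -> : (('X - B%:P) ^+ m * l)^`().[A] * (B - A)
     = - ((('X - B%:P) ^+ m * l)^`().[A] * (A - B)) by ring.
  by rewrite dexp l'E eAB /c /K factS natrM; field.
- by rewrite qB hornerM horner_exp hornerXsubC /c !lE; ring.
- rewrite q'B; apply: (mulIf h0); rewrite -mulrA dexp l'E /c /K factS natrM !lE.
  by field.
Qed.

(** * From interface conditions to a scalar recurrence *)

(** [P], [P'] and [L], [L'] are the value and slope at the left and right ends of a cell, as given
    by [orthogonal_endpoints] with [s] = (-1)^m and [M] = m. Elimination between two consecutive
    interfaces gives the Cayley-Hamilton relation without inverting a matrix. *)
Lemma interface_recurrence {R : numFieldType} (al b1 b2 K M s : R) (x y : nat -> R) :
  s = 1 \/ s = -1 ->
  let L := fun n => x n + y n in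
  let L' := fun n => K * (M * (x n + y n) + y n) in
  let P := fun n => s * x n in
  let P' := fun n => s * (K * (y n - M * x n)) in
  (forall n, (P n.+1 + L n) / 2 - al * (P n.+1 - L n)
             + b2 * (P' n.+1 - L' n) = 0) ->
  (forall n, (P' n.+1 + L' n) / 2 + al * (P' n.+1 - L' n)
             + b1 * (P n.+1 - L n) = 0) ->
  let E := al ^+ 2 + b1 * b2 in
  let Gam := b1 + K ^+ 2 * ((M + 1) ^+ 2 - 1) * b2
             - 2 * (M + 1) * K * (E + 1 / 4) in
  let Lam := - (2 * K) * (E - 1 / 4) in
  forall n, Lam * (x n.+2 + x n) = 2 * (s * Gam) * x n.+1 /\
            Lam * (y n.+2 + y n) = 2 * (s * Gam) * y n.+1.
Proof.
move=> hs L L' P P' e1 e2 E Gam Lam n.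
pose E1 j := (P j.+1 + L j) / 2 - al * (P j.+1 - L j) + b2 * (P' j.+1 - L' j).
pose E2 j := (P' j.+1 + L' j) / 2 + al * (P' j.+1 - L' j) + b1 * (P j.+1 - L j).
have z1 j : E1 j = 0 by apply: e1.
have z2 j : E2 j = 0 by apply: e2.
(* [a] and [c] are the matrices of [E1 j], [E2 j] in (x_j, y_j) and in
   (x_{j+1}, y_{j+1}); adding adj(a) times the equations at [n] to adj(c) times
   those at [n+1] leaves det(a) z_n + det(c) z_{n+2} plus a multiple of z_{n+1}. *)
pose a11 := 1/2 + al - b2 * (K * M).
pose a12 := 1/2 + al - b2 * (K * (M + 1)).
pose a21 := (1/2 - al) * (K * M) - b1.
pose a22 := (1/2 - al) * (K * (M + 1)) - b1.
pose c11 := s * (1/2 - al - b2 * (K * M)).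
pose c12 := s * (b2 * K).
pose c21 := s * (b1 - (1/2 + al) * (K * M)).
pose c22 := s * ((1/2 + al) * K).
split; apply/eqP; rewrite -subr_eq0; apply/eqP.
  transitivity (2 * (a22 * E1 n - a12 * E2 n + c22 * E1 n.+1 - c12 * E2 n.+1)).
    rewrite /E1 /E2 /L /L' /P /P' /Lam /Gam /E /a22 /a12 /c22 /c12.
    by case: hs => ->; field.
  by rewrite !z1 !z2; ring.
transitivity (2 * (a11 * E2 n - a21 * E1 n + c11 * E2 n.+1 - c21 * E1 n.+1)).
  rewrite /E1 /E2 /L /L' /P /P' /Lam /Gam /E /a11 /a21 /c11 /c21.
  by case: hs => ->; field.
by rewrite !z1 !z2; ring.
Qed.

(** * Periodic solutions of linear recurrences *)

(** One turn round the period multiplies [z n] by l^N, yet returns the same value. *)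
Lemma geometric_periodic_eq0 {F : fieldType} (N : nat) (l : F) (z : nat -> F) :
  (forall n, z (n + N)%N = z n) -> l ^+ N != 1 ->
  (forall n, z n.+1 = l * z n) -> forall n, z n = 0.
Proof.
move=> per lN geo n.
have e j : z (n + j)%N = l ^+ j * z n.
  elim: j => [|j IH]; first by rewrite addn0 mul1r.
  by rewrite addnS geo IH exprS mulrA.
have /eqP := e N; rewrite per eq_sym -subr_eq0 -{2}[z n]mul1r -mulrBl mulf_eq0.
by rewrite subr_eq0 (negPf lN) => /eqP.
Qed.

(** The characteristic roots are [l] and its inverse. Factoring the recurrence, z_{n+1} - l z_n is
    geometric of ratio 1/l, hence zero; then [z] itself is geometric of ratio [l]. This also covers
    a double root. *)
Lemma periodic_recurrence_eq0 {F : fieldType} (N : nat) (l t : F) (z : nat -> F) :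
  l ^+ 2 + 1 = t * l -> l ^+ N != 1 ->
  (forall n, z (n + N)%N = z n) ->
  (forall n, z n.+2 + z n = t * z n.+1) -> forall n, z n = 0.
Proof.
move=> lt lN per rec.
have l0 : l != 0.
  by apply: contra_eq_neq lt => ->; rewrite expr0n /= add0r mulr0 oner_neq0.
have d0 : forall n, z n.+1 - l * z n = 0.
  apply: (@geometric_periodic_eq0 _ N l^-1).
  - by move=> n; rewrite -addSn !per.
  - by rewrite exprVn invr_eq1.
  move=> n; apply: (mulfI l0); rewrite mulVKf //.
  have -> : z n.+2 = t * z n.+1 - z n by rewrite -rec addrK.
  transitivity ((t * l) * z n.+1 - l * z n - l ^+ 2 * z n.+1); first by ring.
  by rewrite -lt; ring.
apply: (@geometric_periodic_eq0 _ N l) => // n.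
by apply/eqP; rewrite -subr_eq0 d0.
Qed.

(** * The discrete linear system: uniqueness and solvability *)

Lemma inj_lin_surj {R : fieldType} (vT : vectType R) (f : vT -> vT) :
  linear f -> (forall v, f v = 0 -> v = 0) -> forall w, exists v, f v = w.
Proof.
move=> lf inj w.
pose fL := HB.pack f (GRing.isLinear.Build _ _ _ _ f lf) : {linear vT -> vT}.
pose g := linfun fL.
have k0 : (lker g == 0)%VS.
  rewrite -subv0; apply/subvP => v; rewrite memv_ker lfunE /= memv0 => /eqP e.
  by apply/eqP; apply: inj.
have /memv_imgP [v _ ->] : w \in limg g by rewrite lker0_limgf // memvf.
by exists v; rewrite lfunE.
Qed.

Lemma iter_ordS N (i : 'I_N) n : iter n (@ordS N) i = ((i + n) %% N)%N :> nat.
Proof.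
elim: n => [|n IH] /=; first by rewrite addn0 modn_small.
by rewrite IH -addn1 modnDml addn1 addnS.
Qed.

(** Reduces conditions on all test polynomials to the finitely many monomial equations of a linear
    system. *)
Lemma poly_functional_eq0 {R : nzRingType} (J : {poly R} -> R) m :
  (forall u v, J (u + v) = J u + J v) ->
  (forall c u, J (c *: u) = c * J u) ->
  (forall j, (j < m)%N -> J 'X^j = 0) ->
  forall v : {poly R}, (size v <= m)%N -> J v = 0.
Proof.
move=> JD JZ JX v sv.
have -> : v = \poly_(j < m) v`_j.
  apply/polyP => j; rewrite coef_poly; case: ltnP => // hj.
  by rewrite nth_default // (leq_trans sv).
rewrite poly_def; apply: (big_ind (fun u => J u = 0)) => [|u w ju jw|j _].
- by rewrite -(scale0r 0) JZ mul0r.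
- by rewrite JD ju jw addr0.
by rewrite JZ JX ?mulr0.
Qed.

(** The left side of the value condition in [is_projection], with polynomial evaluation in place of
    one-sided limits; [slope_row] does the same for the derivative condition. *)
Definition value_row {R : numFieldType} {N : nat} (a b : 'I_N -> R) (al b2 : R)
    (p : 'I_N -> {poly R}) (i : 'I_N) : R :=
  ((p (ordS i)).[a (ordS i)] + (p i).[b i]) / 2
  - al * ((p (ordS i)).[a (ordS i)] - (p i).[b i])
  + b2 * ((p (ordS i))^`().[a (ordS i)] - (p i)^`().[b i]).

Definition slope_row {R : numFieldType} {N : nat} (a b : 'I_N -> R) (al b1 : R)
    (p : 'I_N -> {poly R}) (i : 'I_N) : R :=
  ((p (ordS i))^`().[a (ordS i)] + (p i)^`().[b i]) / 2
  + al * ((p (ordS i))^`().[a (ordS i)] - (p i)^`().[b i])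
  + b1 * ((p (ordS i)).[a (ordS i)] - (p i).[b i]).

Lemma value_rowP {R : numFieldType} {N : nat} (a b : 'I_N -> R) (al b2 c : R)
    (p q : 'I_N -> {poly R}) (i : 'I_N) :
  value_row a b al b2 (fun j => c *: p j + q j) i =
  c * value_row a b al b2 p i + value_row a b al b2 q i.
Proof. by rewrite /value_row !derivD !derivZ !hornerD !hornerZ; ring. Qed.

Lemma slope_rowP {R : numFieldType} {N : nat} (a b : 'I_N -> R) (al b1 c : R)
    (p q : 'I_N -> {poly R}) (i : 'I_N) :
  slope_row a b al b1 (fun j => c *: p j + q j) i =
  c * slope_row a b al b1 p i + slope_row a b al b1 q i.
Proof. by rewrite /slope_row !derivD !derivZ !hornerD !hornerZ; ring. Qed.

(** Walking cyclically through the cells turns the two coordinates of [orthogonal_endpoints] into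
    N-periodic sequences obeying [interface_recurrence]. The first hypothesis isolates what has to
    be settled case by case from [Gam] and [Lam]. *)
Lemma discrete_unique {R : numFieldType} {N m : nat} (a b : 'I_N -> R)
    (h al b1 b2 : R) (p : 'I_N -> {poly R}) :
  let K := m.+1%:R / h in
  let E := al ^+ 2 + b1 * b2 in
  let Gam := b1 + K ^+ 2 * ((m%:R + 1) ^+ 2 - 1) * b2
             - 2 * (m%:R + 1) * K * (E + 1 / 4) in
  let Lam := - (2 * K) * (E - 1 / 4) in
  (forall z : nat -> R, (forall n, z (n + N)%N = z n) ->
    (forall n, Lam * (z n.+2 + z n) = 2 * ((-1) ^+ m * Gam) * z n.+1) ->
    forall n, z n = 0) ->
  h != 0 -> (forall i, b i - a i = h) ->
  (forall i, (size (p i) <= m.+2)%N) ->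
  (forall i (v : {poly R}), (size v <= m)%N -> integralp (a i) (b i) (p i * v) = 0) ->
  (forall i, value_row a b al b2 p i = 0) ->
  (forall i, slope_row a b al b1 p i = 0) ->
  forall i, p i = 0.
Proof.
move=> K E Gam Lam rec0 h0 hab sp orth ev es i.
have neab j : a j != b j by rewrite eq_sym -subr_eq0 hab.
have /fin_all_exists [xy xyP] j := orthogonal_endpoints (neab j) (sp j) (orth j).
(* [o n] is the cell [n] steps to the right of [i], cyclically; the claim for [i] is read off at n =
   0. *)
pose o n := iter n (@ordS N) i.
pose x n := (xy (o n)).1; pose y n := (xy (o n)).2.
have oN n : o (n + N)%N = o n.
  by apply: val_inj; rewrite /= /o !iter_ordS addnA modnDr.
have H n : [/\ x n = 0 -> y n = 0 -> p (o n) = 0,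
      (p (o n)).[a (o n)] = (-1) ^+ m * x n,
      (p (o n))^`().[a (o n)] = (-1) ^+ m * (K * (y n - m%:R * x n)),
      (p (o n)).[b (o n)] = x n + y n &
      (p (o n))^`().[b (o n)] = K * (m%:R * (x n + y n) + y n)].
  have := xyP (o n); rewrite /x /y hab; case: (xy _) => x' y' /=; exact.
have s1 : (-1) ^+ m = 1 :> R \/ (-1) ^+ m = -1 :> R.
  by rewrite -signr_odd; case: (odd m); [right; rewrite expr1|left].
have rec := @interface_recurrence R al b1 b2 K m%:R _ x y s1.
have {}rec := rec _ _.
have hP n : (p (o n)).[a (o n)] = (-1) ^+ m * x n by case: (H n).
have hP' n : (p (o n))^`().[a (o n)] = (-1) ^+ m * (K * (y n - m%:R * x n)) by case: (H n).
have hL n : (p (o n)).[b (o n)] = x n + y n by case: (H n).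
have hL' n : (p (o n))^`().[b (o n)] = K * (m%:R * (x n + y n) + y n) by case: (H n).
have {}rec n : Lam * (x n.+2 + x n) = 2 * ((-1) ^+ m * Gam) * x n.+1 /\
   Lam * (y n.+2 + y n) = 2 * ((-1) ^+ m * Gam) * y n.+1.
  apply: rec => j; rewrite -hP' -hL' -hP -hL; [exact: ev | exact: es].
have x0 : x 0%N = 0.
  apply: rec0 => n; first by rewrite /x oN.
  by case: (rec n).
have y0 : y 0%N = 0.
  apply: rec0 => n; first by rewrite /y oN.
  by case: (rec n).
by case: (H 0%N) => /(_ x0 y0).
Qed.

(** The system is square: each cell has m + 2 coefficients, and m moments plus two interface
    equations. Hence trivial kernel implies surjectivity. *)
Lemma discrete_solvable {R : numFieldType} {N m : nat} (a b : 'I_N -> R)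
    (al b1 b2 : R) :
  (forall p : 'I_N -> {poly R},
    (forall i, (size (p i) <= m.+2)%N) ->
    (forall i (v : {poly R}), (size v <= m)%N -> integralp (a i) (b i) (p i * v) = 0) ->
    (forall i, value_row a b al b2 p i = 0) ->
    (forall i, slope_row a b al b1 p i = 0) ->
    forall i, p i = 0) ->
  forall (mom : 'I_N -> nat -> R) (d e : 'I_N -> R),
  exists p : 'I_N -> {poly R},
  [/\ forall i, (size (p i) <= m.+2)%N,
      forall i j, (j < m)%N -> integralp (a i) (b i) (p i * 'X^j) = mom i j,
      forall i, value_row a b al b2 p i = d i &
      forall i, slope_row a b al b1 p i = e i].
Proof.
move=> uniq mom d e.
pose P (W : 'M[R]_(N, m.+2)) i := rVpoly (row i W).
have sP W i : (size (P W i) <= m.+2)%N by apply: size_poly.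
have PL c U V i : P (c *: U + V) i = c *: P U i + P V i by rewrite /P !linearP.
(* Row [i] holds the moments in columns below [m], the value equation in column [m] and the slope
   equation in column [m.+1]. *)
pose sys mo dd ee : 'M[R]_(N, m.+2) := \matrix_(i < N, j < m.+2)
  if (j < m)%N then mo i (j : nat) : R else if (j == m :> nat) then dd i else ee i.
have sysP mo dd ee mo' dd' ee' : sys mo dd ee = sys mo' dd' ee' ->
   [/\ forall i j, (j < m)%N -> mo i j = mo' i j,
       forall i, dd i = dd' i & forall i, ee i = ee' i].
  move=> /matrixP e1; split=> [i j jm|i|i].
  - have jm2 : (j < m.+2)%N by lia.
    by have := e1 i (Ordinal jm2); rewrite !mxE /= jm.
  - have jm2 : (m < m.+2)%N by lia.
    by have := e1 i (Ordinal jm2); rewrite !mxE /= ltnn eqxx.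
  - have jm2 : (m.+1 < m.+2)%N by lia.
    by have := e1 i (Ordinal jm2); rewrite !mxE /= ltnNge leqnSn /= gtn_eqF.
pose f W := sys (fun i j => integralp (a i) (b i) (P W i * 'X^j))
  (value_row a b al b2 (P W)) (slope_row a b al b1 (P W)).
have lf : linear f.
  move=> c U V; apply/matrixP => i j; rewrite !mxE.
  case: ifP => _; first by rewrite PL mulrDl -scalerAl integralpD integralpZ.
  by case: ifP => _; rewrite -?value_rowP -?slope_rowP /value_row /slope_row !PL.
have [|W fW] := inj_lin_surj lf _ (sys mom d e); last first.
  by exists (P W); have [? ? ?] := sysP _ _ _ _ _ _ fW.
move=> W fW.
have f0 : f W = sys (fun _ _ => 0) (fun _ => 0) (fun _ => 0).
  by rewrite fW; apply/matrixP => i j; rewrite !mxE !if_same.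
have [m0 v0 s0] := sysP _ _ _ _ _ _ f0.
have W0 : forall i, P W i = 0.
  apply: uniq => // i; apply: poly_functional_eq0 => [u v|c u|j jm].
  - by rewrite mulrDr integralpD.
  - by rewrite -scalerAr integralpZ.
  exact: m0.
apply/row_matrixP => i; rewrite row0 -[row i W]rVpolyK.
by move: (W0 i); rewrite /P => ->; rewrite linear0.
Qed.

(** * Lebesgue integrals, derivatives and one-sided limits on a cell *)

Lemma integrable_continuous_itv {R : realType} (A B : R) (l r : bool) (f : R -> R) :
  continuous f ->
  lebesgue_measure.-integrable [set` Interval (BSide l A) (BSide r B)]%classic
    (EFin \o f).
Proof.
move=> cf; have cc : lebesgue_measure.-integrable `[A, B]%classic (EFin \o f).
  apply: continuous_compact_integrable; first exact: segment_compact.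
  exact: continuous_subspaceT.
apply: integrableS cc => //.
by apply: subset_itvScc; rewrite bnd_simp.
Qed.

Lemma Rintegral_poly {R : realType} (A B : R) (p : {poly R}) : A < B ->
  \int[lebesgue_measure]_(x in `]A, B[%classic) p.[x] = integralp A B p.
Proof.
move=> AB.
(* The fundamental theorem is applied on the closed interval, so both endpoints are added first. *)
rewrite Rintegral_itv_bndo_bndc; last first.
  by apply: integrable_continuous_itv; exact: continuous_horner.
rewrite Rintegral_itv_obnd_cbnd; last first.
  by apply: integrable_continuous_itv; exact: continuous_horner.
rewrite /Rintegral (@continuous_FTC2 _ (horner p) (horner (primitivep p))) //=.
- by apply: continuous_subspaceT; exact: continuous_horner.
- split=> [x _||]; first exact: derivable_horner.
    by apply: cvg_at_right_filter; exact: continuous_horner.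
  by apply: cvg_at_left_filter; exact: continuous_horner.
by move=> x _; rewrite derive1E derive_val deriv_primitivep.
Qed.

Lemma continuous_mul_horner {R : realType} (u : R -> R) (v : {poly R}) :
  continuous u -> continuous (fun x => u x * v.[x]).
Proof. by move=> cu x; apply: cvgM; [exact: cu | exact: continuous_horner]. Qed.

(** The difference of the two sides is a linear functional of [v]; continuity of [u] gives the
    integrability that this linearity rests on. *)
Lemma moments_of_monomials {R : realType} (A B : R) (m : nat) (u : R -> R)
    (p : {poly R}) :
  continuous u ->
  (forall j, (j < m)%N -> integralp A B (p * 'X^j) =
     \int[lebesgue_measure]_(x in `]A, B[%classic) (u x * ('X^j : {poly R}).[x])) ->
  forall v : {poly R}, (size v <= m)%N -> integralp A B (p * v) =
     \int[lebesgue_measure]_(x in `]A, B[%classic) (u x * v.[x]).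
Proof.
move=> cu H v sv; apply/eqP; rewrite -subr_eq0; apply/eqP.
apply: (@poly_functional_eq0 R (fun v => integralp A B (p * v) -
   \int[lebesgue_measure]_(x in `]A, B[%classic) (u x * v.[x])) m) => //.
- move=> v1 v2.
  under eq_Rintegral do rewrite hornerD mulrDr.
  rewrite RintegralD //; try by apply: integrable_continuous_itv; exact: continuous_mul_horner.
  by rewrite mulrDr integralpD; ring.
- move=> c v1.
  under eq_Rintegral do rewrite hornerZ mulrCA.
  rewrite RintegralZl //; last first.
    by apply: integrable_continuous_itv; exact: continuous_mul_horner.
  by rewrite -scalerAr integralpZ; ring.
by move=> j jm; rewrite H // subrr.
Qed.

Lemma derive1_oo {R : realType} (A B : R) (w : R -> R) (p : {poly R}) :
  (forall x, `]A, B[%classic x -> w x = p.[x]) ->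
  forall x, `]A, B[%classic x -> derive1 w x = p^`().[x].
Proof.
move=> H x xAB; rewrite derive1E.
rewrite (near_eq_derive (g := horner p)); first by rewrite derive_val.
have := near_in_itvoo xAB; apply: filterS => y yAB; exact: H.
Qed.

Lemma lim_left_poly {R : realType} (A B : R) (w : R -> R) (p : {poly R}) :
  A < B -> (forall x, `]A, B[%classic x -> w x = p.[x]) ->
  lim (w x @[x --> B^'-])%classic = p.[B].
Proof.
move=> AB H; apply: cvg_lim => //.
apply: (@cvg_trans _ (p.[x] @[x --> B^'-])%classic).
  apply: near_eq_cvg; near=> x; rewrite H //= in_itv /=; apply/andP; split; near: x.
    exact: nbhs_left_gt.
  exact: nbhs_left_lt.
by apply: cvg_at_left_filter; exact: continuous_horner.
Unshelve. all: by end_near.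
Qed.

Lemma lim_right_poly {R : realType} (A B : R) (w : R -> R) (p : {poly R}) :
  A < B -> (forall x, `]A, B[%classic x -> w x = p.[x]) ->
  lim (w x @[x --> A^'+])%classic = p.[A].
Proof.
move=> AB H; apply: cvg_lim => //.
apply: (@cvg_trans _ (p.[x] @[x --> A^'+])%classic).
  apply: near_eq_cvg; near=> x; rewrite H //= in_itv /=; apply/andP; split; near: x.
    exact: nbhs_right_gt.
  exact: nbhs_right_lt.
by apply: cvg_at_right_filter; exact: continuous_horner.
Unshelve. all: by end_near.
Qed.

(** * Reduction of the projection to the discrete system *)

Lemma nodeS {R : realType} (a b : R) (N j : nat) :
  node a b N j.+1 - node a b N j = mesh_size a b N.
Proof. by rewrite /node -natr1; ring. Qed.

Lemma mesh_size_gt0 {R : realType} (a b : R) (N : nat) :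
  a < b -> (0 < N)%N -> 0 < mesh_size a b N.
Proof. by move=> ab N0; rewrite divr_gt0 ?subr_gt0 // ltr0n. Qed.

(** Cell integrals and one-sided limits see only the values inside the open cells, where [w] and
    [derive1 w] are [p i] and its derivative. *)
Lemma is_projectionP {R : realType} (a b : R) (N m : nat) (al b1 b2 : R)
    (u w : R -> R) (p : 'I_N -> {poly R}) :
  a < b -> (0 < N)%N -> continuous u ->
  (forall i, (size (p i) <= m.+2)%N) ->
  (forall i x, cell a b i x -> w x = (p i).[x]) ->
  let A := fun i : 'I_N => node a b N i in
  let B := fun i : 'I_N => node a b N i.+1 in
  is_projection a b N m.+1 al b1 b2 u w <->
  [/\ forall i (v : {poly R}), (size v <= m)%N ->
         integralp (A i) (B i) (p i * v) =
         \int[lebesgue_measure]_(x in cell a b i) (u x * v.[x]),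
      forall i, value_row A B al b2 p i = u (B i) &
      forall i, slope_row A B al b1 p i = derive1 u (B i)].
Proof.
move=> ab N0 cu sp wp A B.
have AB (i : 'I_N) : A i < B i by rewrite -subr_gt0 nodeS mesh_size_gt0.
have wp' i x : cell a b i x -> derive1 w x = (p i)^`().[x].
  exact: (derive1_oo (wp i)).
have tm i : trace_minus a b w i = (p i).[B i] by exact: (lim_left_poly (AB i) (wp i)).
have tp i : trace_plus a b w i = (p (ordS i)).[A (ordS i)].
  exact: (lim_right_poly (AB _) (wp _)).
have tm' i : trace_minus a b (derive1 w) i = (p i)^`().[B i].
  exact: (lim_left_poly (AB i) (wp' i)).
have tp' i : trace_plus a b (derive1 w) i = (p (ordS i))^`().[A (ordS i)].
  exact: (lim_right_poly (AB _) (wp' _)).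
have vE i : average a b w i - al * jump a b w i + b2 * jump a b (derive1 w) i
    = value_row A B al b2 p i.
  by rewrite /average /jump tm tp tm' tp'.
have sE i : average a b (derive1 w) i + al * jump a b (derive1 w) i
    + b1 * jump a b w i = slope_row A B al b1 p i.
  by rewrite /average /jump tm tp tm' tp'.
have iE (i : 'I_N) (v : {poly R}) : \int[lebesgue_measure]_(x in cell a b i) (w x * v.[x])
    = integralp (A i) (B i) (p i * v).
  rewrite -Rintegral_poly //; apply: eq_Rintegral => x /set_mem xi.
  by rewrite (wp i) // hornerM.
split=> [[_ H1 H2 H3]|[H1 H2 H3]].
  by split=> [i v sv|i|i]; rewrite -?iE -?vE -?sE; [exact: H1|exact: H2|exact: H3].
split=> [i|i v sv|i|i]; first by exists (p i); [exact: sp|exact: (wp i)].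
- by rewrite iE; exact: H1.
- by rewrite vE; exact: H2.
- by rewrite sE; exact: H3.
Qed.

Lemma cell_inj {R : realType} (a b : R) (N : nat) (i j : 'I_N) (x : R) :
  a < b -> (0 < N)%N -> cell a b i x -> cell a b j x -> i = j.
Proof.
move=> ab N0.
have h0 := mesh_size_gt0 ab N0.
have le_ (c d : nat) : (c <= d)%N -> node a b N c <= node a b N d.
  by move=> cd; rewrite /node lerD2l ler_wpM2r ?ler_nat // ltW.
rewrite /cell /= !in_itv /= => /andP[i1 i2] /andP[j1 j2].
apply/val_inj => /=; case: (ltngtP (i : nat) j) => // /le_ h; exfalso.
  by have := lt_trans (le_lt_trans h j1) i2; rewrite ltxx.
by have := lt_trans (le_lt_trans h i1) j2; rewrite ltxx.
Qed.

Lemma broken_poly_of {R : realType} (a b : R) (N : nat) (p : 'I_N -> {poly R}) :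
  a < b -> (0 < N)%N ->
  exists w : R -> R, forall i x, cell a b i x -> w x = (p i).[x].
Proof.
move=> ab N0.
(* Cells are disjoint, so the picked cell is the only one containing [x]; outside all cells the
   value defaults to 0. *)
exists (fun x => if [pick i : 'I_N | `[< cell a b i x >]] is Some i
                 then (p i).[x] else 0) => i x ix.
case: pickP => [j /asboolP jx|/(_ i) /asboolP]; last by [].
by rewrite (cell_inj ab N0 jx ix).
Qed.

(** Existence solves the discrete system and glues the cell polynomials; for uniqueness, the
    difference of two projections solves the homogeneous system. *)
Lemma projection_well_defined_of_rec {R : realType} (a b : R) (N m : nat)
    (al b1 b2 : R) :
  a < b -> (0 < N)%N ->
  let h := mesh_size a b N in
  let Gam := Gamma_k m.+1 h al b1 b2 in
  let Lam := Lambda_k m.+1 h al b1 b2 in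
  (forall z : nat -> R, (forall n, z (n + N)%N = z n) ->
    (forall n, Lam * (z n.+2 + z n) = 2 * ((-1) ^+ m * Gam) * z n.+1) ->
    forall n, z n = 0) ->
  projection_well_defined a b N m.+1 al b1 b2.
Proof.
move=> ab N0 h Gam Lam rec0.
have h0 : h != 0 by rewrite gt_eqF // mesh_size_gt0.
pose A := fun i : 'I_N => node a b N i.
pose B := fun i : 'I_N => node a b N i.+1.
have AB (i : 'I_N) : A i < B i by rewrite -subr_gt0 nodeS mesh_size_gt0.
have uniq (p : 'I_N -> {poly R}) : (forall i, (size (p i) <= m.+2)%N) ->
    (forall i (v : {poly R}), (size v <= m)%N -> integralp (A i) (B i) (p i * v) = 0) ->
    (forall i, value_row A B al b2 p i = 0) ->
    (forall i, slope_row A B al b1 p i = 0) ->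
    forall i, p i = 0.
  apply: (@discrete_unique _ _ _ A B h) => //.
    move=> z per rec; apply: rec0 => // n; have := rec n.
    have -> : b1 + (m.+1%:R / h) ^+ 2 * ((m%:R + 1) ^+ 2 - 1) * b2 -
      2 * (m%:R + 1) * (m.+1%:R / h) * (al ^+ 2 + b1 * b2 + 1 / 4) = Gam.
      by rewrite /Gam /Gamma_k -natr1; field.
    have -> : - (2 * (m.+1%:R / h)) * (al ^+ 2 + b1 * b2 - 1 / 4) = Lam.
      by rewrite /Lam /Lambda_k -natr1; field.
    by [].
  by move=> i; rewrite /A /B nodeS.
move=> u [_ cu _ _].
have [p [sp mp vp tp]] := discrete_solvable uniq
  (fun i j => \int[lebesgue_measure]_(x in cell a b i) (u x * ('X^j : {poly R}).[x]))
  (fun i => u (B i)) (fun i => derive1 u (B i)).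
have [w wp] := broken_poly_of p ab N0.
have mpv := fun i => moments_of_monomials cu (mp i).
exists w; split; first exact/(is_projectionP al b1 b2 ab N0 cu sp wp).
move=> w' Hw' i x ix.
have [bw' _ _ _] := Hw'.
have /fin_all_exists [p' p'P] : forall i : 'I_N, exists p' : {poly R},
    (size p' <= m.+2)%N /\ forall x, cell a b i x -> w' x = p'.[x].
  by move=> j; have [q sq wq] := bw' j; exists q.
have sp' j := (p'P j).1; have wp' j := (p'P j).2.
have [mp' vp' tp'] := (is_projectionP al b1 b2 ab N0 cu sp' wp').1 Hw'.
rewrite (wp i) // (wp' i) //; apply/eqP; rewrite -subr_eq0 -hornerN -hornerD; apply/eqP.
(* This shape of the difference matches [value_rowP] and [slope_rowP]. *)
have e j : p' j - p j = -1 *: p j + p' j by rewrite scaleN1r addrC.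
rewrite (_ : p' i - p i = 0) ?horner0 // e.
apply: (uniq (fun j => -1 *: p j + p' j)) => [j|j v sv|j|j].
- rewrite (leq_trans (size_polyD _ _)) // geq_max sp' andbT.
  by rewrite (leq_trans (size_scale_leq _ _)).
- by rewrite mulrDl -scalerAl integralpD integralpZ mpv // mp' // mulN1r addNr.
- by rewrite value_rowP vp vp' mulN1r addNr.
by rewrite slope_rowP tp tp' mulN1r addNr.
Qed.

(** * Characteristic roots in the three cases *)

Theorem lemma3p3 (R : realType) (a b : R) (N k : nat)
    (alpha1 beta1 beta2 : R)
    (hab : a < b) (hN : (0 < N)%N) (hk : (1 <= k)%N)
    (hne : alpha1 ^+ 2 + beta1 * beta2 != 1 / 4) :
  let h := mesh_size a b N in
  let Gam := Gamma_k k h alpha1 beta1 beta2 in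
  let Lam := Lambda_k k h alpha1 beta1 beta2 in
  let well_defined := projection_well_defined a b N k alpha1 beta1 beta2 in
  [/\ `|Gam| > `|Lam| -> well_defined,
      `|Gam| = `|Lam| ->
        odd N -> (if odd k then Gam = - Lam else Gam = Lam) -> well_defined &
      `|Gam| < `|Lam| ->
        (-1 : R[i]) ^+ ((k + 1) * N) *
          ((Gam / Lam) +i* Num.sqrt (1 - (Gam / Lam) ^+ 2)) ^+ N != 1 ->
        well_defined].
Proof.
case: k hk => // m _ h Gam Lam well_defined.
have h0 : h != 0 by rewrite gt_eqF // mesh_size_gt0.
have L0 : Lam != 0.
  rewrite /Lam /Lambda_k !mulf_neq0 ?invr_eq0 ?oppr_eq0 ?pnatr_eq0 ?subr_eq0 //.
  by rewrite !mulf_neq0 ?invr_eq0 ?pnatr_eq0.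
(* [t] is half the trace of the transfer matrix: the characteristic equation is l^2 + 1 = 2 t l. *)
pose t := (-1) ^+ m * (Gam / Lam).
(* The root may lie in an extension [F] of [R], as the third case requires; injectivity of [f]
   brings the vanishing back to [R]. *)
have wd (F : fieldType) (f : {rmorphism R -> F}) (l : F) :
    l ^+ 2 + 1 = 2 * f t * l -> l ^+ N != 1 -> well_defined.
  move=> lt lN; apply: projection_well_defined_of_rec => // z per rec n.
  apply: (fmorph_inj f); rewrite rmorph0.
  apply: (periodic_recurrence_eq0 (z := f \o z) lt lN) => [j|j] /=.
    by rewrite per.
  rewrite -rmorphD; have -> : z j.+2 + z j = 2 * t * z j.+1.
    by apply: (mulfI L0); rewrite rec /t -/Gam -/Lam; field.
  by rewrite !rmorphM rmorph_nat.
split.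
- move=> LG.
  have t1 : 1 < `|t|.
    by rewrite normrM normrX normrN1 expr1n mul1r normf_div ltr_pdivlMr ?normr_gt0 // mul1r.
  have t2 : 1 < t ^+ 2 by rewrite -real_normK ?num_real // exprn_egt1.
  pose r := Num.sqrt (t ^+ 2 - 1).
  have r2 : r ^+ 2 = t ^+ 2 - 1 by rewrite sqr_sqrtr // subr_ge0 ltW.
  have el : (t + r) ^+ 2 + 1 = 2 * t * (t + r).
    transitivity (t^+2 + 2 * t * r + (r^+2 + 1)); first by ring.
    by rewrite r2; ring.
  apply: (wd R idfun (t + r)) => //.
  (* A real root of unity has absolute value 1, hence square 1; the characteristic equation then
     gives t (t + r) = 1, so [t] has absolute value 1, against [t1]. *)
  apply/eqP => lN.
  have n1 : `|t + r| = 1.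
    by apply/eqP; rewrite -(pexpr_eq1 hN) // -normrX lN normr1.
  have tl : t * (t + r) = 1.
    by move: el; rewrite -[X in X + 1]real_normK ?num_real // n1 expr1n; lra.
  by have := congr1 Num.norm tl; rewrite normrM n1 mulr1 normr1 => nt; rewrite nt ltxx in t1.
- move=> _ oN GL.
  (* Since k = m + 1, both parities of [k] lead to t = -1, with double root -1, whose odd power is
     not 1. *)
  have t1 : t = -1.
    rewrite /t; move: GL; rewrite /= -signr_odd; case: (odd m) => /= ->.
      by rewrite expr1 divff // mulr1.
    by rewrite expr0 mul1r mulNr divff.
  apply: (wd R idfun (-1)); first by rewrite /= t1; ring.
  by rewrite -signr_odd oN expr1; lra.
move=> GL lN.
pose c := Gam / Lam.
have c1 : `|c| < 1 by rewrite normf_div ltr_pdivrMr ?normr_gt0 // mul1r.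
have c2 : c ^+ 2 < 1 by rewrite -real_normK ?num_real // exprn_ilt1.
pose r := Num.sqrt (1 - c ^+ 2).
have r2 : r ^+ 2 = 1 - c ^+ 2 by rewrite sqr_sqrtr // subr_ge0 ltW.
apply: (wd R[i] (real_complex R) ((-1) ^+ m * (c +i* r))).
  have sq : ((-1) ^+ m : R[i]) ^+ 2 = 1 by rewrite exprAC sqrrN !expr1n.
  have el : (c +i* r) ^+ 2 + 1 = 2 * c%:C * (c +i* r).
    apply/eqP; rewrite eq_complex /=; apply/andP; split; apply/eqP.
      by transitivity (c ^+ 2 - r ^+ 2 + 1); [ring | rewrite r2; ring].
    by ring.
  rewrite /t -/c /= rmorphM rmorphXn rmorphN1 exprMn sq mul1r el.
  by transitivity (((-1) ^+ m) ^+ 2 * (2 * c%:C * (c +i* r))); [rewrite sq mul1r | ring].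
move: lN; rewrite -/c -/r exprMn -exprM.
(* With k = m + 1 the exponent (k + 1) N is m N + 2 N, and the even part drops out. *)
by rewrite addn1 -addn2 mulnDl exprD [X in _ * X * _]exprM sqrrN !expr1n mulr1.
Qed.
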